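(* Let $A\in\mathbb{M}_n(\mathbf{C})$ be accretive-dissipative and partitioned as $$A=\begin{bmatrix} A_{11} & A_{12}\\ A_{21} & A_{22}\end{bmatrix},$$ where the diagonal blocks $A_{11}$ and $A_{22}$ are square of orders $k$ and $l$ respectively, with $k,l>0$ and $k+l=n$. Let $m=\min\{k,l\}$. Then $$|\det A|\le a\,|\det A_{11}|\cdot|\det A_{22}|,$$ where $$a=\begin{cases} 2^{3m/2}, & \text{if } m\le n/3,\\ 2^{n/2}, & \text{if } n/3<m\le n/2.\end{cases}$$
   Context: $\mathbb{M}_n(\mathbf{C})$ denotes the set of $n\times n$ complex matrices, and $A^*$ denotes the conjugate transpose of $A$. A matrix $A\in\mathbb{M}_n(\mathbf{C})$ is called accretive-dissipative if, writing $A=B+iC$ with $B=\frac{A+A^*}{2}$ and $C=\frac{A-A^*}{2i}$ (both Hermitian), both $B$ and $C$ are (Hermitian) positive definite. *)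

(* Defs.v *)
From HB Require Import structures.
From mathcomp Require Export all_boot all_order all_algebra.
From mathcomp Require Export sesquilinear spectral.
From mathcomp Require Export complex.
From mathcomp Require Export reals exp.

Set Implicit Arguments.
Unset Strict Implicit.
Unset Printing Implicit Defensive.

Import Order.TTheory GRing.Theory Num.Theory.
Local Open Scope ring_scope.
Local Open Scope sesquilinear_scope.

Section AccretiveDissipative.
Variables (C : numClosedFieldType) (n : nat).
Implicit Types A M : 'M[C]_n.

(* [0 < z] in a [numClosedFieldType] entails that [z] is real. *)
Definition posdefmx M : Prop :=
  M \is hermsymmx /\
  forall x : 'cV[C]_n, x != 0 -> 0 < (x ^t* *m M *m x) 0 0.

Definition re_mx A : 'M[C]_n := 2^-1 *: (A + A ^t* ).

Definition im_mx A : 'M[C]_n := (2 * 'i)^-1 *: (A - A ^t* ).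

Definition accretive_dissipative A : Prop :=
  posdefmx (re_mx A) /\ posdefmx (im_mx A).

End AccretiveDissipative.

(* The second branch is the range n/3 < m <= n/2: the bound m <= n/2 always
   holds since m = min(k, l) and n = k + l. *)
Definition det_const (R : realType) (k l : nat) : R :=
  let m := minn k l in
  let n := (k + l)%N in
  if m%:R <= n%:R / 3 :> R then 2 `^ (3 * m%:R / 2) else 2 `^ (n%:R / 2).

(* Main.v *)
(** Diagonalizing Re S and Im S simultaneously by congruence, the inequalities
    |1 + id| <= 1 + d <= sqrt 2 |1 + id| for d > 0 give
    |det S| <= det (Re S + Im S) <= 2^(n/2) |det S|
    for every accretive-dissipative S of order n. Fischer's inequality for the
    positive definite matrix Re A + Im A then yields the constant 2^(n/2).

    For the constant 2^(3l/2), let S = A22 - A21 A11^-1 A12 be the Schur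
    complement, which is again accretive-dissipative. Evaluating the forms of A
    at the vectors (u, x), (iu, x) and (-iu, x) with A11 u + A12 x = 0 shows
    Re S + Im S <= 2 (Re A22 + Im A22), hence
    |det S| <= 2^l det (Re A22 + Im A22) <= 2^(3l/2) |det A22|.
    Exchanging the two blocks gives the constant 2^(3k/2). *)

Require Import Defs.
Import Order.TTheory GRing.Theory Num.Theory.
From mathcomp Require Import ring.
Set Implicit Arguments.
Unset Strict Implicit.
Unset Printing Implicit Defensive.
Local Open Scope ring_scope.
Local Open Scope sesquilinear_scope.

(** * Block determinants through Schur complements *)

Lemma det_block_schur_ul (R : comUnitRingType) k l (A : 'M[R]_k)
    (B : 'M[R]_(k, l)) (C : 'M[R]_(l, k)) (D : 'M[R]_l) : A \in unitmx ->
  \det (block_mx A B C D) = \det A * \det (D - C *m invmx A *m B).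
Proof.
move=> uA.
have -> : block_mx A B C D =
    block_mx A 0 C 1%:M *m
    block_mx 1%:M (invmx A *m B) 0 (D - C *m invmx A *m B).
  rewrite mulmx_block !mulmx1 !mul1mx !mulmx0 !mul0mx !addr0 mulKVmx //.
  by rewrite mulmxA [C *m _ *m B + _]addrC subrK.
by rewrite det_mulmx det_lblock det_ublock !det1 mulr1 mul1r.
Qed.

Lemma det_block_schur_dr (R : comUnitRingType) k l (A : 'M[R]_k)
    (B : 'M[R]_(k, l)) (C : 'M[R]_(l, k)) (D : 'M[R]_l) : D \in unitmx ->
  \det (block_mx A B C D) = \det D * \det (A - B *m invmx D *m C).
Proof.
move=> uD.
have -> : block_mx A B C D =
    block_mx 1%:M B 0 D *m
    block_mx (A - B *m invmx D *m C) 0 (invmx D *m C) 1%:M.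
  rewrite mulmx_block !mulmx1 !mul1mx !mulmx0 !mul0mx !add0r mulKVmx //.
  by rewrite mulmxA subrK.
by rewrite det_mulmx det_lblock det_ublock !det1 mulr1 mul1r.
Qed.

(** * Sesquilinear forms and the Cartesian decomposition *)

Section SesquilinearForm.
Variable C : numClosedFieldType.

(** Rectangular matrices are allowed so that the off-diagonal blocks of a partition have forms
    too. *)
Definition sform m n (A : 'M[C]_(m, n)) (u : 'cV_m) (v : 'cV_n) : C :=
  (u ^t* *m A *m v) 0 0.

Lemma adjM m n p (A : 'M[C]_(m, n)) (B : 'M_(n, p)) :
  (A *m B) ^t* = B ^t* *m A ^t*.
Proof. by rewrite trmx_mul map_mxM. Qed.

Lemma adjD m n (A B : 'M[C]_(m, n)) : (A + B) ^t* = A ^t* + B ^t*.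
Proof. by rewrite raddfD map_mxD. Qed.

Lemma adjZ m n a (A : 'M[C]_(m, n)) : (a *: A) ^t* = a^* *: A ^t*.
Proof. by rewrite linearZ /= map_mxZ. Qed.

Lemma sformDm m n (A B : 'M[C]_(m, n)) u v :
  sform (A + B) u v = sform A u v + sform B u v.
Proof. by rewrite /sform mulmxDr mulmxDl mxE. Qed.

Lemma sformZm m n a (A : 'M[C]_(m, n)) u v :
  sform (a *: A) u v = a * sform A u v.
Proof. by rewrite /sform -scalemxAr -scalemxAl mxE. Qed.

Lemma sformZl m n a (A : 'M[C]_(m, n)) u v :
  sform A (a *: u) v = a^* * sform A u v.
Proof. by rewrite /sform adjZ -!scalemxAl mxE. Qed.

Lemma sformZr m n a (A : 'M[C]_(m, n)) u v :
  sform A u (a *: v) = a * sform A u v.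
Proof. by rewrite /sform -scalemxAr mxE. Qed.

Lemma sform0l m n (A : 'M[C]_(m, n)) v : sform A 0 v = 0.
Proof. by rewrite /sform trmx0 map_mx0 !mul0mx mxE. Qed.

Lemma sform0r m n (A : 'M[C]_(m, n)) u : sform A u 0 = 0.
Proof. by rewrite /sform mulmx0 mxE. Qed.

Lemma sform_adj m n (A : 'M[C]_(m, n)) u v : sform (A ^t*) v u = (sform A u v)^*.
Proof.
rewrite /sform -[in LHS](trmxCK u) -!adjM mulmxA.
by rewrite !mxE.
Qed.

Lemma sform_mul m n p q (A : 'M[C]_(m, n)) (P : 'M_(p, m)) (Q : 'M_(n, q)) u v :
  sform (P *m A *m Q) u v = sform A (P ^t* *m u) (Q *m v).
Proof. by rewrite /sform adjM trmxCK !mulmxA. Qed.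

Lemma sform_block k l (A : 'M[C]_k) (B : 'M_(k, l)) (D : 'M_(l, k))
    (E : 'M_l) u x :
  sform (block_mx A B D E) (col_mx u x) (col_mx u x) =
  sform A u u + sform B u x + sform D x u + sform E x x.
Proof.
rewrite /sform tr_col_mx map_row_mx mul_row_block mul_row_col !mulmxDl !mxE.
by ring.
Qed.

Lemma sform_delta n (A : 'M[C]_n) i :
  sform A (delta_mx i 0) (delta_mx i 0) = A i i.
Proof.
rewrite /sform trmx_delta map_delta_mx.
by rewrite -rowE -colE !mxE.
Qed.

Lemma sform_re n (A : 'M[C]_n) x : sform (re_mx A) x x = 'Re (sform A x x).
Proof. by rewrite /re_mx sformZm sformDm sform_adj ReE mulrC. Qed.

Lemma sform_im n (A : 'M[C]_n) x : sform (im_mx A) x x = 'Im (sform A x x).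
Proof.
rewrite /im_mx -scaleN1r sformZm sformDm sformZm sform_adj ImE invfM invCi.
by ring.
Qed.

Lemma re_mx_herm n (A : 'M[C]_n) : re_mx A \is hermsymmx.
Proof.
apply/is_hermitianmxP; rewrite expr0 scale1r /re_mx adjZ adjD trmxCK addrC.
by rewrite -[2]/(2%:R) fmorphV rmorph_nat.
Qed.

Lemma im_mx_herm n (A : 'M[C]_n) : im_mx A \is hermsymmx.
Proof.
apply/is_hermitianmxP; rewrite expr0 scale1r /im_mx -scaleN1r adjZ adjD adjZ trmxCK.
rewrite rmorphN rmorph1 !scaleN1r -opprB scalerN -scaleNr; congr (_ *: _).
by rewrite fmorphV rmorphM /= -[2]/(2%:R) rmorph_nat conjCi mulrN invrN.
Qed.

(** The values of the form at nonzero vectors lie in the open first quadrant. In this shape the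
    property passes to diagonal blocks and Schur complements by a choice of vectors. *)
Lemma accretive_dissipativeP n (A : 'M[C]_n) :
  accretive_dissipative A <->
  forall x, x != 0 -> 0 < 'Re (sform A x x) /\ 0 < 'Im (sform A x x).
Proof.
split=> [[[_ hR] [_ hI]] x x0|h].
  by rewrite -sform_re -sform_im; split; [exact: hR | exact: hI].
split; split; rewrite ?re_mx_herm ?im_mx_herm // => x x0.
  by have [] := h x x0; rewrite -sform_re.
by have [] := h x x0; rewrite -sform_im.
Qed.

Lemma re_im_mx n (A : 'M[C]_n) : A = re_mx A + 'i *: im_mx A.
Proof.
rewrite /re_mx /im_mx scalerA invfM mulrCA divff ?neq0Ci // mulr1 -scalerDr.
rewrite addrACA subrr addr0 -mulr2n -scaler_nat scalerA mulVf ?scale1r //.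
by rewrite pnatr_eq0.
Qed.

End SesquilinearForm.

(** * Positive definite matrices and simultaneous diagonalization *)

Section PositiveDefinite.
Variable C : numClosedFieldType.

Lemma posdefmxD n (P Q : 'M[C]_n) : posdefmx P -> posdefmx Q -> posdefmx (P + Q).
Proof.
move=> [/is_hermitianmxP hP pP] [/is_hermitianmxP hQ pQ]; split.
  apply/is_hermitianmxP; rewrite adjD scalerDr.
  by rewrite -hP -hQ.
move=> x x0; rewrite -/(sform _ x x) sformDm.
by apply: addr_gt0; [exact: pP | exact: pQ].
Qed.

Lemma adj_unit n (T : 'M[C]_n) : (T ^t* \in unitmx) = (T \in unitmx).
Proof. by rewrite map_unitmx unitmx_tr. Qed.

Lemma mul_unitmx_neq0 n (T : 'M[C]_n) (x : 'cV_n) :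
  T \in unitmx -> x != 0 -> T *m x != 0.
Proof.
move=> uT; apply: contraNneq => Tx0.
by rewrite -(mulKmx uT x) Tx0 mulmx0.
Qed.

Lemma herm_congr n (P T : 'M[C]_n) :
  P \is hermsymmx -> T *m P *m T ^t* \is hermsymmx.
Proof.
move=> /is_hermitianmxP hP; apply/is_hermitianmxP; move: hP.
by rewrite expr0 !scale1r !adjM trmxCK mulmxA => <-.
Qed.

Lemma posdefmx_congr n (P T : 'M[C]_n) :
  T \in unitmx -> posdefmx P -> posdefmx (T *m P *m T ^t*).
Proof.
move=> uT [hP pP]; split; first exact: herm_congr.
move=> x x0; rewrite -/(sform _ x x) sform_mul.
by apply: pP; rewrite mul_unitmx_neq0 ?adj_unit.
Qed.

Lemma posdefmx_diag_gt0 n (P : 'M[C]_n) i : posdefmx P -> 0 < P i i.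
Proof.
move=> [_ pP]; rewrite -sform_delta; apply: pP.
by apply/eqP => /matrixP/(_ i 0)/eqP; rewrite !mxE !eqxx oner_eq0.
Qed.

Lemma herm_spectral n (Q : 'M[C]_n) : Q \is hermsymmx ->
  exists (U : 'M_n) (d : 'rV_n), [/\ U \is unitarymx & Q = U ^t* *m diag_mx d *m U].
Proof.
move=> /hermitian_normalmx/orthomx_spectralP hQ.
exists (spectralmx Q), (spectral_diag Q); split; first exact: spectral_unitarymx.
by rewrite -invmx_unitary ?spectral_unitarymx.
Qed.

Lemma posdefmx_factor n (P : 'M[C]_n) : posdefmx P ->
  exists2 T : 'M_n, T \in unitmx & P = T *m T ^t*.
Proof.
move=> pP; have [U [d [uU dP]]] := herm_spectral pP.1.
have d_gt0 i : 0 < d 0 i.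
  (* This congruent matrix is [diag_mx d], so its diagonal entries are the eigenvalues. *)
  have /(posdefmx_diag_gt0 i) : posdefmx (U *m P *m U ^t*).
    by apply: posdefmx_congr => //; exact: unitarymx_unit.
  rewrite dP !mulmxA mulmxtVK // (unitarymxP uU) mul1mx.
  by rewrite mxE eqxx mulr1n.
pose s : 'rV_n := \row_i sqrtC (d 0 i).
have sE : diag_mx s ^t* = diag_mx s.
  rewrite tr_diag_mx map_diag_mx; congr diag_mx; apply/rowP => i; rewrite !mxE.
  by apply: conj_Creal; rewrite ger0_real // sqrtC_ge0 ltW.
exists (U ^t* *m diag_mx s); last first.
  rewrite adjM trmxCK sE mulmxA -[U ^t* *m _ *m _]mulmxA mulmx_diag dP.
  congr (_ *m diag_mx _ *m _); apply/rowP => i.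
  by rewrite !mxE -expr2 sqrtCK.
rewrite unitmx_mul adj_unit unitarymx_unit //= unitmxE det_diag unitfE.
by apply/prodf_neq0 => i _; rewrite mxE sqrtC_eq0 gt_eqF.
Qed.

(** Factor [P], diagonalize the Hermitian matrix obtained from [Q] by congruence with [invmx T], and
    absorb the unitary factor into [T], which leaves the factorization of [P] intact. *)
Lemma posdefmx_codiag n (P Q : 'M[C]_n) : posdefmx P -> Q \is hermsymmx ->
  exists (T : 'M_n) (d : 'rV_n), [/\ T \in unitmx, P = T *m T ^t* & Q = T *m diag_mx d *m T ^t*].
Proof.
move=> /posdefmx_factor [T uT dP] hQ.
have [U [d [uU dQ]]] := herm_spectral (herm_congr (invmx T) hQ).
exists (T *m U ^t*), d; split.
- by rewrite unitmx_mul uT adj_unit unitarymx_unit.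
- by rewrite adjM trmxCK mulmxA mulmxKtV.
rewrite adjM trmxCK !mulmxA.
rewrite -[T *m _ *m _]mulmxA -[T *m _ *m _]mulmxA -dQ !mulmxA mulmxV // mul1mx.
by rewrite -mulmxA -adjM mulmxV // trmx1 map_mx1 mulmx1.
Qed.

Lemma det_congr_gt0 n (T : 'M[C]_n) : T \in unitmx -> 0 < \det T * \det (T ^t*).
Proof.
by move=> uT; rewrite det_map_mx det_tr -normCK exprn_gt0 // normr_gt0 -unitfE.
Qed.

(** Taking [z = 'i] gives the determinant of a matrix, and [z = 1] that of the sum of its real and
    imaginary parts. *)
Lemma det_pencil n (T : 'M[C]_n) d z :
  \det (T *m T ^t* + z *: (T *m diag_mx d *m T ^t*)) =
  \det T * \det (T ^t*) * \prod_i (1 + z * d 0 i).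
Proof.
have -> : T *m T ^t* + z *: (T *m diag_mx d *m T ^t*) =
    T *m diag_mx (\row_i (1 + z * d 0 i)) *m T ^t*.
  rewrite scalemxAl scalemxAr -[X in X *m T ^t* + _]mulmx1 -mulmxDl -mulmxDr.
  congr (_ *m _ *m _); apply/matrixP => i j; rewrite !mxE.
  by case: eqP; rewrite ?mulr1n // !mulr0n mulr0 addr0.
rewrite !det_mulmx det_diag mulrAC; congr (_ * _).
by apply: eq_bigr => i _; rewrite mxE.
Qed.

Lemma posdefmx_det_gt0 n (P : 'M[C]_n) : posdefmx P -> 0 < \det P.
Proof.
by move=> /posdefmx_factor [T uT ->]; rewrite det_mulmx det_congr_gt0.
Qed.

(** After simultaneous diagonalization, the ratio of the determinants is the product of the
    eigenvalues of [Q] relative to [P], each at least 1. *)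
Lemma posdefmx_det_le n (P Q : 'M[C]_n) : posdefmx P -> Q \is hermsymmx ->
  (forall x, sform P x x <= sform Q x x) -> \det P <= \det Q.
Proof.
move=> pP hQ le_PQ; have [T [d [uT dP dQ]]] := posdefmx_codiag pP hQ.
have d_ge1 i : 1 <= d 0 i.
  (* At this vector the form of [P] is 1 and that of [Q] is [d 0 i]. *)
  have := le_PQ (invmx (T ^t*) *m delta_mx i 0).
  rewrite dP -[X in X *m T ^t*]mulmx1 dQ !sform_mul !mulKVmx ?adj_unit //.
  by rewrite !sform_delta !mxE eqxx.
rewrite dP dQ !det_mulmx mulrAC det_diag.
apply: ler_peMr; first by rewrite ltW ?det_congr_gt0.
by elim/big_ind: _ => // x y; exact: mulr_ege1.
Qed.

End PositiveDefinite.

(** * Comparing an accretive-dissipative matrix with its real plus imaginary part *)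

Section AccretiveDissipativeDet.
Variable C : numClosedFieldType.

(** A positive definite stand-in for an accretive-dissipative [A], with determinant comparable to
    that of [A]. *)
Definition re_im_sum n (A : 'M[C]_n) : 'M[C]_n := re_mx A + im_mx A.

Lemma posdefmx_re_im_sum n (A : 'M[C]_n) :
  accretive_dissipative A -> posdefmx (re_im_sum A).
Proof. by case; exact: posdefmxD. Qed.

Lemma sform_re_im_sum n (A : 'M[C]_n) x :
  sform (re_im_sum A) x x = 'Re (sform A x x) + 'Im (sform A x x).
Proof. by rewrite /re_im_sum sformDm sform_re sform_im. Qed.

Lemma norm_1Di (d : C) : 0 < d ->
  `|1 + 'i * d| <= 1 + d <= sqrtC 2 * `|1 + 'i * d|.
Proof.
move=> d0; have d_ge0 := ltW d0; apply/andP; split.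
  by apply: le_trans (ler_normD _ _) _; rewrite normr1 normrM normCi mul1r ger0_norm.
rewrite -(@ler_pXn2r _ 2) ?nnegrE ?addr_ge0 ?mulr_ge0 ?sqrtC_ge0 //.
rewrite exprMn sqrtCK normC2_rect ?ger0_real ?ler01 // expr1n.
rewrite -subr_ge0; have -> : 2 * (1 + d ^+ 2) - (1 + d) ^+ 2 = (d - 1) ^+ 2 by ring.
by rewrite real_exprn_even_ge0 // rpredB ?ger0_real ?ler01.
Qed.

Lemma accretive_dissipative_det n (A : 'M[C]_n) : accretive_dissipative A ->
  `|\det A| <= \det (re_im_sum A) <= sqrtC 2 ^+ n * `|\det A|.
Proof.
move=> [pR pI]; have [T [d [uT dR dI]]] := posdefmx_codiag pR pI.1.
have d_gt0 i : 0 < d 0 i.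
  have uV : invmx T \in unitmx by rewrite unitmx_inv.
  have := posdefmx_diag_gt0 i (posdefmx_congr uV pI).
  rewrite dI !mulmxA mulVmx // mul1mx -mulmxA -adjM mulVmx //.
  by rewrite trmx1 map_mx1 mulmx1 mxE eqxx.
have -> : \det A = \det T * \det (T ^t*) * \prod_i (1 + 'i * d 0 i).
  by rewrite [in LHS](re_im_mx A) dR dI det_pencil.
have -> : \det (re_im_sum A) = \det T * \det (T ^t*) * \prod_i (1 + d 0 i).
  rewrite /re_im_sum dR dI -[X in _ + X]scale1r det_pencil.
  by congr (_ * _); apply: eq_bigr => i _; rewrite mul1r.
have T_gt0 := det_congr_gt0 uT.
rewrite normrM gtr0_norm // mulrCA !ler_pM2l // normr_prod.
have -> : sqrtC 2 ^+ n = \prod_(i < n) sqrtC 2 :> C.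
  by rewrite prodr_const card_ord.
rewrite -big_split /=.
apply/andP; split; apply: ler_prod => i _;
  have /andP[h1 h2] := norm_1Di (d_gt0 i).
  by rewrite h1 normr_ge0.
by rewrite h2 addr_ge0 // ltW.
Qed.

(** The upper bound on the positive determinant of [re_im_sum A] by a multiple of [|det A|] forces
    the latter to be positive. *)
Lemma accretive_dissipative_unit n (A : 'M[C]_n) :
  accretive_dissipative A -> A \in unitmx.
Proof.
move=> hA; rewrite unitmxE unitfE -normr_gt0.
have /andP[_ ] := accretive_dissipative_det hA.
move=> /(lt_le_trans (posdefmx_det_gt0 (posdefmx_re_im_sum hA))).
by rewrite pmulr_rgt0 // exprn_gt0 // sqrtC_gt0 ltr0n.
Qed.

End AccretiveDissipativeDet.

(** * Schur complements and Fischer's inequality *)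

Section Schur.
Variables (C : numClosedFieldType) (k l : nat).
Implicit Types (A : 'M[C]_k) (B : 'M[C]_(k, l)) (D : 'M[C]_(l, k)) (E : 'M[C]_l).

Definition schur A B D E : 'M[C]_l := E - D *m invmx A *m B.

(* The vector [u] solves [A u + B x = 0], so that [block_mx A B D E] sends
   [col_mx u x] to [col_mx 0 (S x)], where [S] is the Schur complement. *)
Lemma schur_kernel A B x (u := - (invmx A *m B *m x)) : A \in unitmx ->
  sform A u u + sform B u x = 0.
Proof.
move=> uA; rewrite /sform -!mulmxA.
have -> : A *m u = - (B *m x) by rewrite mulmxN -mulmxA mulKVmx.
by rewrite mulmxN mxE addNr.
Qed.

Lemma sform_schur A B D E x (u := - (invmx A *m B *m x)) :
  sform (schur A B D E) x x = sform D x u + sform E x x.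
Proof.
by rewrite addrC /sform mulmxBr mulmxBl mulmxN !mulmxA !mxE.
Qed.

Lemma col_mx_neq0r (u : 'cV[C]_k) (x : 'cV[C]_l) : x != 0 -> col_mx u x != 0.
Proof. by apply: contraNneq; rewrite -col_mx0 => /eq_col_mx[_ ->]. Qed.

Lemma col_mx_neq0l (u : 'cV[C]_k) (x : 'cV[C]_l) : u != 0 -> col_mx u x != 0.
Proof. by apply: contraNneq; rewrite -col_mx0 => /eq_col_mx[-> _]. Qed.

Lemma accretive_dissipative_ul A B D E :
  accretive_dissipative (block_mx A B D E) -> accretive_dissipative A.
Proof.
move=> /accretive_dissipativeP hM; apply/accretive_dissipativeP => u u0.
have := hM _ (col_mx_neq0l 0 u0).
by rewrite sform_block !sform0r sform0l !addr0.
Qed.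

Lemma accretive_dissipative_dr A B D E :
  accretive_dissipative (block_mx A B D E) -> accretive_dissipative E.
Proof.
move=> /accretive_dissipativeP hM; apply/accretive_dissipativeP => x x0.
have := hM _ (col_mx_neq0r 0 x0).
by rewrite sform_block !sform0r !sform0l !add0r.
Qed.

(** The form of the Schur complement at [x] is that of the whole matrix at [col_mx u x], with [u] as
    in [schur_kernel]. *)
Lemma accretive_dissipative_schur A B D E :
  accretive_dissipative (block_mx A B D E) ->
  accretive_dissipative (schur A B D E).
Proof.
move=> hM; have uA := accretive_dissipative_unit (accretive_dissipative_ul hM).
move/accretive_dissipativeP: hM => hM; apply/accretive_dissipativeP => x x0.
have := hM _ (col_mx_neq0r (- (invmx A *m B *m x)) x0).
by rewrite sform_block schur_kernel // add0r -sform_schur.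
Qed.

Lemma schur_re_im_le A B D E x :
  accretive_dissipative (block_mx A B D E) ->
  sform (re_im_sum (schur A B D E)) x x <= sform (2 *: re_im_sum E) x x.
Proof.
move=> hM; have uA := accretive_dissipative_unit (accretive_dissipative_ul hM).
have [->|x0] := eqVneq x 0; first by rewrite !sform0r.
rewrite sformZm !sform_re_im_sum sform_schur.
set u := - _; have := schur_kernel B x uA; rewrite -/u => Au0.
move/accretive_dissipativeP: hM => hM.
(* With [a = sform A u u], [b = sform B u x = - a], [d = sform D x u] and
   [e = sform E x x], positivity of the real part at [('i u, x)] and of the
   imaginary part at [(- 'i u, x)] sum to [Re d + Im d <= Re e + Im e]. *)
have [+ _] := hM _ (col_mx_neq0r ('i *: u) x0).
have [_ +] := hM _ (col_mx_neq0r (- 'i *: u) x0).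
rewrite !sform_block !sformZl !sformZr conjCi.
have -> : (- 'i : C)^* = 'i by rewrite rmorphN /= conjCi opprK.
set a := sform A u u in Au0 *; set d := sform D x u; set e := sform E x x.
have -> : sform B u x = - a by apply/eqP; rewrite -addr_eq0 addrC Au0.
have -> : 'i * (- 'i * a) = a by rewrite mulrA mulrN mulCii opprK mul1r.
have -> : - 'i * ('i * a) = a by rewrite mulrA mulNr mulCii opprK mul1r.
rewrite !mulNr !mulrN !opprK !(raddfD, raddfN) /= !(ReMil, ImMil) => hI hR.
rewrite -subr_ge0.
have -> : 2 * ('Re e + 'Im e) - ('Re d + 'Re e + ('Im d + 'Im e)) =
  'Im a - 'Re a - 'Re d + 'Im e + ('Re a - 'Im a - 'Im d + 'Re e) by ring.
exact: ltW (addr_gt0 hI hR).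
Qed.

Lemma schur_det_le A B D E : accretive_dissipative (block_mx A B D E) ->
  `|\det (schur A B D E)| <= sqrtC 2 ^+ (3 * l) * `|\det E|.
Proof.
move=> hM; have hE := accretive_dissipative_dr hM.
have hS := accretive_dissipative_schur hM.
have /andP[le1 _] := accretive_dissipative_det hS.
apply: le_trans le1 _.
have herm2E : 2 *: re_im_sum E \is hermsymmx.
  have /is_hermitianmxP := (posdefmx_re_im_sum hE).1.
  rewrite expr0 scale1r => h; apply/is_hermitianmxP.
  by rewrite expr0 scale1r adjZ -h -[2]/(2%:R) rmorph_nat.
have le_SE x := schur_re_im_le x hM.
have := posdefmx_det_le (posdefmx_re_im_sum hS) herm2E le_SE.
move=> /le_trans; apply; rewrite detZ.
(* The part [2 * l] pays for the scalar 2 in an order [l] determinant, the part [l] for passing from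
   [re_im_sum E] back to [E]. *)
have -> : (3 * l = 2 * l + l)%N by rewrite mulSn addnC.
rewrite exprD exprM sqrtCK -mulrA ler_pM2l ?exprn_gt0 ?ltr0n //.
by have /andP[_ ] := accretive_dissipative_det hE.
Qed.

(** The form of the Schur complement is that of [E] minus the nonnegative term [sform A u u], so its
    determinant is at most that of [E]. *)
Lemma fischer A B D E : posdefmx (block_mx A B D E) ->
  \det (block_mx A B D E) <= \det A * \det E.
Proof.
move=> [/is_hermitianmxP]; rewrite expr0 scale1r tr_block_mx map_block_mx.
move=> /eq_block_mx[hA hB _ hE] pM.
have pA : posdefmx A.
  split=> [|u u0]; first by apply/is_hermitianmxP; rewrite expr0 scale1r.
  have := pM _ (col_mx_neq0l 0 u0).
  by rewrite -/(sform _ _ _) sform_block !sform0r sform0l !addr0.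
have uA : A \in unitmx by rewrite unitmxE unitfE gt_eqF ?posdefmx_det_gt0.
have hE' : E \is hermsymmx by apply/is_hermitianmxP; rewrite expr0 scale1r.
have pS : posdefmx (schur A B D E).
  split=> [|x x0]; last first.
    have := pM _ (col_mx_neq0r (- (invmx A *m B *m x)) x0).
    by rewrite -/(sform _ _ _) sform_block schur_kernel // add0r -sform_schur.
  apply/is_hermitianmxP; rewrite expr0 scale1r /schur -scaleN1r adjD adjZ !adjM.
  by rewrite rmorphN rmorph1 trmx_inv map_invmx -hA -hE hB trmxCK mulmxA.
rewrite det_block_schur_ul // ler_pM2l ?posdefmx_det_gt0 //.
apply: (posdefmx_det_le pS hE') => x; rewrite sform_schur gerDr.
set u := - _; have := schur_kernel B x uA; rewrite -/u => Au0.
have -> : sform D x u = - sform A u u.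
  have -> : D = B ^t* by rewrite hB trmxCK.
  rewrite sform_adj (_ : sform B u x = - sform A u u); last first.
    by apply/eqP; rewrite -addr_eq0 addrC Au0.
  by rewrite rmorphN /= -sform_adj -hA.
rewrite oppr_le0; have [->|u0] := eqVneq u 0; first by rewrite sform0r.
by apply: ltW; apply: pA.2.
Qed.

End Schur.

(** The off-diagonal blocks stay existential because the bound in [fischer] does not mention
    them. *)
Lemma re_im_sum_block (C : numClosedFieldType) k l (A : 'M[C]_k) (B : 'M[C]_(k, l))
    (D : 'M[C]_(l, k)) (E : 'M[C]_l) :
  exists B' D', re_im_sum (block_mx A B D E) =
    block_mx (re_im_sum A) B' D' (re_im_sum E).
Proof.
rewrite /re_im_sum /re_mx /im_mx tr_block_mx map_block_mx opp_block_mx.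
by rewrite !add_block_mx !scale_block_mx add_block_mx; eexists; eexists.
Qed.

(** * Bounds for two-by-two block determinants *)

Section DeterminantBounds.
Variables (C : numClosedFieldType) (k l : nat).
Implicit Types (A : 'M[C]_k) (B : 'M[C]_(k, l)) (D : 'M[C]_(l, k)) (E : 'M[C]_l).

Lemma accretive_dissipative_swap A B D E :
  accretive_dissipative (block_mx A B D E) ->
  accretive_dissipative (block_mx E D B A).
Proof.
move=> /accretive_dissipativeP hM; apply/accretive_dissipativeP => x.
rewrite -[x]vsubmxK => x0.
have /hM : col_mx (dsubmx x) (usubmx x) != 0.
  by apply: contraNneq x0; rewrite -!col_mx0 => /eq_col_mx[-> ->].
rewrite !sform_block.
set a := sform A _ _; set b := sform B _ _.
set d := sform D _ _; set e := sform E _ _.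
by have -> : a + b + d + e = e + d + b + a by ring.
Qed.

Lemma det_block_le_half A B D E : accretive_dissipative (block_mx A B D E) ->
  `|\det (block_mx A B D E)| <= sqrtC 2 ^+ (k + l) * (`|\det A| * `|\det E|).
Proof.
move=> hM; have hA := accretive_dissipative_ul hM.
have hE := accretive_dissipative_dr hM.
have /andP[h _] := accretive_dissipative_det hM; apply: le_trans h _.
have := posdefmx_re_im_sum hM.
have [B' [D' ->]] := re_im_sum_block A B D E => /fischer/le_trans; apply.
(* The constant splits into one power of [sqrtC 2] per diagonal block. *)
rewrite exprD mulrACA; apply: ler_pM.
- exact/ltW/posdefmx_det_gt0/posdefmx_re_im_sum.
- exact/ltW/posdefmx_det_gt0/posdefmx_re_im_sum.
- by have /andP[] := accretive_dissipative_det hA.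
- by have /andP[] := accretive_dissipative_det hE.
Qed.

Lemma det_block_le_dr A B D E : accretive_dissipative (block_mx A B D E) ->
  `|\det (block_mx A B D E)| <= sqrtC 2 ^+ (3 * l) * (`|\det A| * `|\det E|).
Proof.
move=> hM; have hA := accretive_dissipative_ul hM.
rewrite det_block_schur_ul ?accretive_dissipative_unit // normrM mulrCA.
exact/ler_wpM2l/schur_det_le.
Qed.

End DeterminantBounds.

Lemma det_block_le_ul (C : numClosedFieldType) k l (A : 'M[C]_k)
    (B : 'M[C]_(k, l)) (D : 'M[C]_(l, k)) (E : 'M[C]_l) :
  accretive_dissipative (block_mx A B D E) ->
  `|\det (block_mx A B D E)| <= sqrtC 2 ^+ (3 * k) * (`|\det A| * `|\det E|).
Proof.
move=> hM; have hE := accretive_dissipative_dr hM.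
rewrite det_block_schur_dr ?accretive_dissipative_unit // normrM.
rewrite [`|\det A| * _]mulrC mulrCA.
exact/ler_wpM2l/schur_det_le/accretive_dissipative_swap.
Qed.

(** * Real powers of 2 and the final case analysis *)

Local Open Scope complex_scope.

(** Both branches of [det_const] have this form, with [n] equal to three times the minimum or to
    [k + l]. *)
Lemma powR2_half (R : realType) n : (2 `^ (n%:R / 2))%:C = sqrtC 2 ^+ n :> R[i].
Proof.
rewrite mulrC powRrM powR_mulrn ?powR_ge0 // rmorphXn /=; congr (_ ^+ n).
have s0 : 0 <= (2 `^ 2^-1)%:C :> R[i] by rewrite ler0c powR_ge0.
rewrite -[LHS]sqrCK // -rmorphXn /= powR12_sqrt // sqr_sqrtr //.
by rewrite rmorph_nat.
Qed.

Theorem theorem2 (R : realType) (k l : nat) (A : 'M[R[i]]_(k + l)) :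
  (0 < k)%N -> (0 < l)%N ->
  accretive_dissipative A ->
  `|\det A| <=
    (det_const R k l)%:C * (`|\det (ulsubmx A)| * `|\det (drsubmx A)|).
Proof.
move=> _ _; rewrite -{1 2}[A]submxK => hA; rewrite /det_const /=.
case: ifP => _; last by rewrite powR2_half; exact: det_block_le_half.
rewrite -natrM powR2_half.
(* If [k <= l] the minimum is [k], and the complement is taken with the lower right block as pivot;
   otherwise the roles are exchanged. *)
by case: leqP => _; [exact: det_block_le_ul | exact: det_block_le_dr].
Qed.
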